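(* Let $G$ be a nontrivial finite group. For every $n>3$ there exists at least one element $f\in P_G(n)$ such that $f$ is not generated from below. In particular, the operad $P_G$ in $G$-sets is not finitely generated for $|G|>1$.
   Context: **Permutations.** $\Sigma_n$ is the symmetric group on $\{1,\dots,n\}$, with product $\sigma\tau$ meaning ''first $\tau$, then $\sigma$''. For $\sigma\in\Sigma_n$ and $k_1,\dots,k_n\ge 0$ with $k=k_1+\dots+k_n$, split $\{1,\dots,k\}$ into $n$ consecutive (possibly empty) blocks of sizes $k_1,\dots,k_n$. The block permutation $\sigma\langle k_1,\dots,k_n\rangle\in\Sigma_k$ permutes the blocks according to $\sigma$: it sends the $i$-th element of the $j$-th block to $i+\sum_{l:\sigma(l)<\sigma(j)}k_l$. For $\tau_j\in\Sigma_{k_j}$, the block sum $\tau_1\oplus\dots\oplus\tau_n\in\Sigma_k$ permutes by $\tau_j$ within the $j$-th block. Put $\sigma\langle\tau_1,\dots,\tau_n\rangle=\sigma\langle k_1,\dots,k_n\rangle\cdot(\tau_1\oplus\dots\oplus\tau_n)$. **The operad $P_G$.** For a finite group $G$, $P_G$ is the (symmetric) operad in $G$-sets with $P_G(n)$ the set of all functions $f\colon G\to\Sigma_n$ (not necessarily homomorphisms), for $n\ge 0$. The left $G$-action is $(g\cdot f)(h)=f(hg)$, the right $\Sigma_n$-action is $(f\cdot\sigma)(h)=f(h)\sigma$, the composition is $\gamma(f;f_1,\dots,f_n)(h)=f(h)\langle f_1(h),\dots,f_n(h)\rangle$, and the operadic identity is the unique element $\mathbb 1\in P_G(1)$. If $f\in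 P_G(n)$, its arity is $|f|=n$. **Generated from below.** An element $f\in P_G(n)$ is *$\gamma$-generated from below* if there exist $s,h_1,\dots,h_{|s|}\in\bigcup_{i=0}^{n-1}P_G(i)$ such that $f=\gamma(s;h_1,\dots,h_{|s|})$. An element $f'\in P_G(n)$ is *generated from below* if $f'=f\cdot\sigma$ for some $f\in P_G(n)$ that is $\gamma$-generated from below and some $\sigma\in\Sigma_n$. **Finite generation.** A suboperad $\mathcal N$ of an operad $\mathcal O$ in $G$-sets consists of subsets $\mathcal N(n)\subseteq\mathcal O(n)$, closed under the $G$- and $\Sigma_n$-actions, containing the operadic identity $\mathbb 1\in\mathcal{N}(1)$ and closed under operadic composition. For a sequence of subsets $S=\{S_i\subseteq\mathcal O(i)\}_{i\ge0}$, $\langle S\rangle$ is the smallest suboperad with $S_i\subseteq\langle S\rangle(i)$ for all $i$. The operad $\mathcal O$ is *finitely generated* if there is such an $S$ with $\left|\coprod_{i}S_i\right|<\infty$ and $\langle S\rangle=\mathcal O$. *)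

(* Defs.v *)
From HB Require Import structures.
From mathcomp Require Import all_boot all_order all_fingroup.
From mathcomp Require Import boolp classical_sets cardinality.

Set Implicit Arguments.
Unset Strict Implicit.
Unset Printing Implicit Defensive.

Local Open Scope nat_scope.

(* In MathComp [(s * t)%g] means "first s, then t"; the convention for operads
   is the opposite one, so [symM s t] is "first t, then s". *)
Definition symM n (s t : 'S_n) : 'S_n := (t * s)%g.

Lemma symME n (s t : 'S_n) i : symM s t i = s (t i).
Proof. exact: permM. Qed.

(* Indices start from 0.  The sum of the family k : 'I_n -> nat is cut into
   consecutive blocks by [tagnat]: the position p is the element
   [tagnat.sig2 p : 'I_(k j)] of the block j = [tagnat.sig1 p], and
   [tagnat.Rank] is the inverse correspondence. *)

Section Blocks.
Variables (n : nat) (k : 'I_n -> nat).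

Definition block_offset (s : 'S_n) (j : 'I_n) : nat :=
  \sum_(l < n | s l < s j) k l.

Lemma block_offset_lt (s : 'S_n) l j :
  s l < s j -> block_offset s l + k l <= block_offset s j.
Proof.
move=> lt_lj; rewrite /block_offset [leqRHS](bigD1 l) //= addnC leq_add2l.
rewrite big_mkcond [leqRHS]big_mkcond /=; apply: leq_sum => t _.
case: ltnP => // lt_tl; rewrite (ltn_trans lt_tl lt_lj) /=.
by case: eqP lt_tl => // ->; rewrite ltnn.
Qed.

Lemma block_offset_le (s : 'S_n) j : block_offset s j + k j <= \sum_l k l.
Proof.
rewrite [leqRHS](bigD1 j) //= addnC leq_add2l /block_offset.
rewrite big_mkcond [leqRHS]big_mkcond /=; apply: leq_sum => t _.
by case: ltnP => // lt_tj; case: eqP lt_tj => // ->; rewrite ltnn.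
Qed.

Definition block_val (s : 'S_n) (u : {j : 'I_n & 'I_(k j)}) : nat :=
  tagged u + block_offset s (tag u).

Lemma block_val_lt (s : 'S_n) u : block_val s u < \sum_l k l.
Proof.
by rewrite /block_val addnC (leq_trans _ (block_offset_le s (tag u))) // ltn_add2l.
Qed.

Lemma block_val_ltE (s : 'S_n) (l j : 'I_n) (i : 'I_(k l)) (i' : 'I_(k j)) :
  l != j ->
  (block_val s (Tagged _ i) < block_val s (Tagged _ i')) = (s l < s j).
Proof.
rewrite /block_val /= => ne_lj; case: (ltngtP (s l) (s j)) => [lt|lt|eqs].
- apply: leq_trans (leq_addl _ _); apply: leq_trans (block_offset_lt lt).
  by rewrite addnC ltn_add2l.
- apply/negbTE; rewrite -leqNgt; apply: ltnW.
  apply: leq_trans (leq_addl _ _); apply: leq_trans (block_offset_lt lt).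
  by rewrite addnC ltn_add2l.
- by case/eqP: ne_lj; apply/(@perm_inj _ s)/val_inj.
Qed.

Lemma block_val_inj (s : 'S_n) : injective (block_val s).
Proof.
move=> [l i] [j i'] eq_v; have [eq_lj|ne_lj] := eqVneq l j; last first.
  have := block_val_ltE s i i' ne_lj; rewrite eq_v ltnn.
  have := block_val_ltE s i' i; rewrite eq_sym eq_v ltnn => /(_ ne_lj).
  case: ltngtP => // eqs; case/eqP: ne_lj.
  by apply/(@perm_inj _ s)/val_inj.
case: j / eq_lj => /= in i' eq_v *; congr existT; apply: val_inj.
by move/eqP: eq_v; rewrite /block_val /= eqn_add2r => /eqP.
Qed.

Definition block_perm_fun s (p : 'I_(\sum_j k j)) : 'I_(\sum_j k j) :=
  Ordinal (block_val_lt s (tagnat.sig p)).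

Lemma block_perm_fun_inj s : injective (block_perm_fun s).
Proof.
by move=> p q [eq_v]; apply: tagnat.sig_inj; apply: block_val_inj eq_v.
Qed.

(* s<k_1,...,k_n>: sends the element i of the block j to
   i + \sum_(l | s l < s j) k l *)
Definition block_perm (s : 'S_n) : 'S_(\sum_j k j) :=
  perm (@block_perm_fun_inj s).


Definition block_sum_fun (t : forall j, 'S_(k j)) (p : 'I_(\sum_j k j)) :
    'I_(\sum_j k j) :=
  tagnat.Rank (tagnat.sig1 p) (t (tagnat.sig1 p) (tagnat.sig2 p)).

Lemma block_sum_fun_inj t : injective (block_sum_fun t).
Proof.
move=> p q /tagnat.rank_inj eq_t; apply: tagnat.sig_inj.
move: eq_t; rewrite /tagnat.sig1 /tagnat.sig2.
case: (tagnat.sig p) (tagnat.sig q) => [j i] [j' i'] /= eq_t.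
have eq_j : j = j' by case: eq_t.
case: j' / eq_j => /= in i' eq_t *.
by move/eqP: eq_t; rewrite eq_Tagged /= => /eqP /perm_inj ->.
Qed.

Definition block_sum (t : forall j, 'S_(k j)) : 'S_(\sum_j k j) :=
  perm (@block_sum_fun_inj t).

(* s<t_1,...,t_n> *)
Definition block_comp (s : 'S_n) (t : forall j, 'S_(k j)) :
    'S_(\sum_j k j) :=
  symM (block_perm s) (block_sum t).

Lemma block_permE s p : block_perm s p = block_val s (tagnat.sig p) :> nat.
Proof. by rewrite permE. Qed.

Lemma block_compE s t p :
  block_comp s t p =
  t (tagnat.sig1 p) (tagnat.sig2 p) + block_offset s (tagnat.sig1 p) :> nat.
Proof.
by rewrite symME block_permE permE /block_sum_fun /tagnat.Rank tagnat.rankK.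
Qed.

Lemma block_comp_RankE s t j (i : 'I_(k j)) :
  block_comp s t (tagnat.Rank j i) = t j i + block_offset s j :> nat.
Proof.
by rewrite symME block_permE permE /block_sum_fun /tagnat.Rank
  /tagnat.sig1 /tagnat.sig2 !tagnat.rankK.
Qed.

Lemma block_comp_ltE s t p q :
  (block_comp s t p < block_comp s t q) =
  (block_val s (Tagged (fun j => 'I_(k j)) (t _ (tagnat.sig2 p)))
   < block_val s (Tagged (fun j => 'I_(k j)) (t _ (tagnat.sig2 q)))).
Proof. by rewrite !block_compE. Qed.

Local Notation blk i := (Tagged (fun j => 'I_(k j)) i).

Lemma sum_blocks (j : 'I_n) (A : pred 'I_n) (B : pred 'I_(k j))
    (C : pred {j : 'I_n & 'I_(k j)}) (M : {j : 'I_n & 'I_(k j)} -> nat) :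
  ~~ A j ->
  (forall l (i : 'I_(k l)), l != j -> C (blk i) = A l) ->
  (forall i : 'I_(k j), C (blk i) = B i) ->
  \sum_(p < \sum_j k j | C (tagnat.sig p)) M (tagnat.sig p) =
  \sum_(i | B i) M (blk i) + \sum_(l | A l) \sum_(i : 'I_(k l)) M (blk i).
Proof.
move=> nAj CA CB; rewrite (reindex (@tagnat.rank n k)) /=; last exact: onW_bij tagnat.rank_bij.
under eq_bigl do rewrite tagnat.rankK.
under eq_bigr do rewrite tagnat.rankK.
transitivity (\sum_l \sum_(i : 'I_(k l) | C (blk i)) M (blk i)).
  rewrite (@sig_big_dep _ _ _ _ (fun l => 'I_(k l)) xpredT
             (fun l i => C (blk i)) (fun l i => M (blk i))).
  by apply: eq_big => [[]|[]].
rewrite (bigD1 j) //=; congr (_ + _); first by apply: eq_bigl => i; rewrite CB.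
rewrite [RHS]big_mkcond [RHS](bigD1 j) //= (negbTE nAj) add0n.
apply: eq_bigr => l ne_lj; case: ifP => Al.
  by apply: eq_bigl => i; rewrite CA.
by rewrite big_pred0 // => i; rewrite CA.
Qed.

End Blocks.

Lemma block_arity n (k : 'I_n -> nat) (s : 'S_n) :
  \sum_j k j = \sum_j k (s^-1%g j).
Proof. exact: (reindex_inj (@perm_inj _ s^-1%g)). Qed.

(* Both sides of an operad identity may live in arities that are only
   propositionally equal, so such identities are stated in {n & O n}. *)
Record operad (gT : finGroupType) := Operad {
  op_elt :> nat -> Type;
  gact : forall n, gT -> op_elt n -> op_elt n;
  sact : forall n, op_elt n -> 'S_n -> op_elt n;
  op_one : op_elt 1;
  op_comp : forall n (k : 'I_n -> nat),
    op_elt n -> (forall j, op_elt (k j)) -> op_elt (\sum_j k j);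
  gact1 : forall n (x : op_elt n), gact 1%g x = x;
  gactM : forall n a b (x : op_elt n), gact (a * b)%g x = gact a (gact b x);
  sact1 : forall n (x : op_elt n), sact x 1%g = x;
  sactM : forall n (x : op_elt n) s t, sact x (symM s t) = sact (sact x s) t;
  gact_sact : forall n a (x : op_elt n) s,
    gact a (sact x s) = sact (gact a x) s;
  gact_one : forall a, gact a op_one = op_one;
  gact_comp : forall n (k : 'I_n -> nat) a (x : op_elt n)
      (y : forall j, op_elt (k j)),
    gact a (op_comp x y) = op_comp (gact a x) (fun j => gact a (y j));
  op_comp1 : forall n (x : op_elt n),
    Tagged op_elt (op_comp x (fun _ => op_one)) = Tagged op_elt x;
  op_1comp : forall n (x : op_elt n),
    Tagged op_elt (op_comp op_one (fun _ => x)) = Tagged op_elt x;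
  op_compA : forall n (k : 'I_n -> nat) (m : forall j, 'I_(k j) -> nat)
      (x : op_elt n) (y : forall j, op_elt (k j))
      (z : forall j i, op_elt (m j i)),
    Tagged op_elt (op_comp (op_comp x y)
      (fun p : 'I_(\sum_j k j) => z (tagnat.sig1 p) (tagnat.sig2 p))) =
    Tagged op_elt (op_comp x (fun j => op_comp (y j) (z j)));
  op_comp_sactl : forall n (k : 'I_n -> nat) (x : op_elt n) s
      (y : forall j, op_elt (k j)),
    Tagged op_elt (op_comp (sact x s) y) =
    Tagged op_elt (sact (op_comp x (fun j => y (s^-1%g j)))
                        (cast_perm (block_arity k s) (block_perm k s)));
  op_comp_sactr : forall n (k : 'I_n -> nat) (x : op_elt n)
      (y : forall j, op_elt (k j)) (t : forall j, 'S_(k j)),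
    op_comp x (fun j => sact (y j) (t j)) = sact (op_comp x y) (block_sum t)
}.

Section PG.
Variable gT : finGroupType.

Definition PG_elt (n : nat) : Type := {ffun gT -> 'S_n}.

Definition PG_gact n (a : gT) (f : PG_elt n) : PG_elt n :=
  [ffun h => f (h * a)%g].

Definition PG_sact n (f : PG_elt n) (s : 'S_n) : PG_elt n :=
  [ffun h => symM (f h) s].

Definition PG_one : PG_elt 1 := [ffun=> 1%g].

Definition PG_comp n (k : 'I_n -> nat) (f : PG_elt n)
    (g : forall j, PG_elt (k j)) : PG_elt (\sum_j k j) :=
  [ffun h => block_comp (f h) (fun j => g j h)].

Lemma PG_one_unique (f : PG_elt 1) : f = PG_one.
Proof. by apply/ffunP => h; apply/permP => i; rewrite !ord1. Qed.

Lemma PG_eq m n (f : PG_elt m) (g : PG_elt n) (e : m = n) :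
  (forall h i, f h i = g h (cast_ord e i) :> nat) ->
  Tagged PG_elt f = Tagged PG_elt g.
Proof.
case: n / e g => g eq_fg; congr Tagged; apply/ffunP => h; apply/permP => i.
by apply: val_inj; rewrite /= eq_fg cast_ord_id.
Qed.

Lemma PG_gact1 n (f : PG_elt n) : PG_gact 1%g f = f.
Proof. by apply/ffunP => h; rewrite ffunE mulg1. Qed.

Lemma PG_gactM n a b (f : PG_elt n) :
  PG_gact (a * b)%g f = PG_gact a (PG_gact b f).
Proof. by apply/ffunP => h; rewrite !ffunE mulgA. Qed.

Lemma PG_sact1 n (f : PG_elt n) : PG_sact f 1%g = f.
Proof. by apply/ffunP => h; rewrite ffunE /symM mul1g. Qed.

Lemma PG_sactM n (f : PG_elt n) s t :
  PG_sact f (symM s t) = PG_sact (PG_sact f s) t.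
Proof. by apply/ffunP => h; rewrite !ffunE /symM mulgA. Qed.

Lemma PG_gact_sact n a (f : PG_elt n) s :
  PG_gact a (PG_sact f s) = PG_sact (PG_gact a f) s.
Proof. by apply/ffunP => h; rewrite !ffunE. Qed.

Lemma PG_gact_one a : PG_gact a PG_one = PG_one.
Proof. exact: PG_one_unique. Qed.

Lemma PG_gact_comp n (k : 'I_n -> nat) a (f : PG_elt n)
    (g : forall j, PG_elt (k j)) :
  PG_gact a (PG_comp f g) = PG_comp (PG_gact a f) (fun j => PG_gact a (g j)).
Proof.
apply/ffunP => h; rewrite !ffunE; apply/permP => p; apply: val_inj.
by rewrite /= !block_compE ffunE.
Qed.

Lemma sum1_lt n (s : 'S_n) (j : 'I_n) : \sum_(l < n | s l < s j) 1 = s j.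
Proof.
rewrite (reindex_inj (@perm_inj _ s^-1%g)) /=.
under eq_bigl do rewrite permKV.
by rewrite -(big_ord_widen _ (fun=> 1)) ?sum1_card ?card_ord // ltnW.
Qed.

Lemma PG_comp1 n (f : PG_elt n) :
  Tagged PG_elt (PG_comp f (fun _ => PG_one)) = Tagged PG_elt f.
Proof.
have e : \sum_(j < n) 1 = n by rewrite sum1_card card_ord.
apply: (PG_eq (e := e)) => h p; rewrite !ffunE block_compE ord1 add0n.
rewrite /block_offset sum1_lt; congr (val (f h _)); apply: val_inj => /=.
rewrite [RHS]tagnat.rect ord1 addn0.
have := sum1_lt 1%g (tagnat.sig1 p); rewrite perm1 => {1}<-.
by apply: eq_bigl => l; rewrite perm1.
Qed.

Lemma PG_1comp n (f : PG_elt n) :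
  Tagged PG_elt (PG_comp PG_one (fun _ => f)) = Tagged PG_elt f.
Proof.
have e : \sum_(j < 1) n = n by rewrite big_ord1.
apply: (PG_eq (e := e)) => h p; rewrite !ffunE block_compE.
rewrite /block_offset big_pred0 ?addn0 => [|l]; last by rewrite !ord1 ltnn.
congr (val (f h _)); apply: val_inj => /=; rewrite [RHS]tagnat.rect.
by rewrite big_pred0 // => l; rewrite !ord1 ltnn.
Qed.

Lemma PG_compA n (k : 'I_n -> nat) (m : forall j, 'I_(k j) -> nat)
    (x : PG_elt n) (y : forall j, PG_elt (k j))
    (z : forall j i, PG_elt (m j i)) :
  Tagged PG_elt (PG_comp (PG_comp x y)
    (fun p : 'I_(\sum_j k j) => z (tagnat.sig1 p) (tagnat.sig2 p))) =
  Tagged PG_elt (PG_comp x (fun j => PG_comp (y j) (z j))).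
Proof.
pose M (u : {j : 'I_n & 'I_(k j)}) := m (tag u) (tagged u).
have e : \sum_(p < \sum_j k j) M (tagnat.sig p) = \sum_j \sum_i m j i.
  rewrite (reindex (@tagnat.rank n k)) /=; last exact: onW_bij tagnat.rank_bij.
  under eq_bigr do rewrite tagnat.rankK.
  by rewrite (@sig_big_dep _ _ _ _ (fun j => 'I_(k j)) xpredT (fun _ => xpredT) m).
apply: (PG_eq (e := e)) => h q; rewrite !ffunE.
set p := tagnat.sig1 q; set r := tagnat.sig2 q.
set j := tagnat.sig1 p; set i := tagnat.sig2 p.
have -> : cast_ord e q = tagnat.Rank j (tagnat.Rank i r).
  apply: ord_inj; rewrite !tagnat.RankEsum.
  transitivity (nat_of_ord q) => //; rewrite {1}(tagnat.rect q) -/p -/r.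
  rewrite addnA; congr (_ + _); rewrite addnC.
  pose C (u : {j : 'I_n & 'I_(k j)}) := tagnat.rank u < p.
  rewrite -(@sum_blocks n k j (fun l => l < j) (fun i' => i' < i) C M).
  - by apply: eq_bigl => p'; rewrite /C tagnat.sigK.
  - by rewrite ltnn.
  - move=> l i' ne_lj; rewrite /C tagnat.rankEsum /=.
    rewrite (tagnat.rect p) -/j -/i.
    have H := block_val_ltE 1%g i' i ne_lj.
    rewrite /block_val /block_offset /= !perm1 in H.
    rewrite -H addnC [X in _ < X]addnC.
    by congr (_ + _ < _ + _); apply: eq_bigl => t; rewrite !perm1.
  - move=> i'; rewrite /C tagnat.rankEsum /=.
    by rewrite (tagnat.rect p) ltn_add2l.
rewrite block_compE block_comp_RankE ffunE block_comp_RankE -/p -/r -addnA; congr (_ + _).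
pose C (u : {j : 'I_n & 'I_(k j)}) :=
  block_val (x h) (Tagged (fun j => 'I_(k j)) (y (tag u) h (tagged u)))
  < block_val (x h) (Tagged (fun j => 'I_(k j)) (y j h i)).
rewrite /block_offset.
rewrite -(@sum_blocks n k j (fun l => x h l < x h j)
           (fun i' => y j h i' < y j h i) C M).
- by apply: eq_bigl => p'; rewrite block_comp_ltE.
- by rewrite ltnn.
- by move=> l i' ne_lj; rewrite /C block_val_ltE.
- by move=> i'; rewrite /C ltn_add2r.
Qed.

Lemma PG_comp_sactl n (k : 'I_n -> nat) (x : PG_elt n) s
    (y : forall j, PG_elt (k j)) :
  Tagged PG_elt (PG_comp (PG_sact x s) y) =
  Tagged PG_elt (PG_sact (PG_comp x (fun j => y (s^-1%g j)))
                         (cast_perm (block_arity k s) (block_perm k s))).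
Proof.
apply: (PG_eq (e := block_arity k s)) => h p.
rewrite !ffunE block_compE symME cast_permE cast_ordK.
set j := tagnat.sig1 p; set i := tagnat.sig2 p.
have e : k j = k (s^-1%g (s j)) by rewrite permK.
have -> : cast_ord (block_arity k s) (block_perm k s p) =
          tagnat.Rank (s j) (cast_ord e i).
  apply: ord_inj; rewrite tagnat.RankEsum /= block_permE /block_val addnC.
  congr (_ + _); rewrite /block_offset [RHS](reindex_inj (@perm_inj _ s)) /=.
  by apply: eq_bigr => l _; rewrite permK.
rewrite block_comp_RankE; congr (_ + _).
  by case: _ / (esym (permK s j)) e => e; rewrite cast_ord_id.
rewrite /block_offset [RHS](reindex_inj (@perm_inj _ s)) /=.
by apply: eq_big => [l|l _]; rewrite ?permK // !symME.
Qed.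

Lemma PG_comp_sactr n (k : 'I_n -> nat) (x : PG_elt n)
    (y : forall j, PG_elt (k j)) (t : forall j, 'S_(k j)) :
  PG_comp x (fun j => PG_sact (y j) (t j)) = PG_sact (PG_comp x y) (block_sum t).
Proof.
apply/ffunP => h; rewrite !ffunE; apply/permP => p; apply: ord_inj.
rewrite block_compE ffunE symME [X in _ = nat_of_ord X]symME.
by rewrite [block_sum _ _]permE block_comp_RankE.
Qed.

Definition PG : operad gT :=
  @Operad gT PG_elt PG_gact PG_sact PG_one PG_comp
    PG_gact1 PG_gactM PG_sact1 PG_sactM PG_gact_sact PG_gact_one PG_gact_comp
    PG_comp1 PG_1comp PG_compA PG_comp_sactl PG_comp_sactr.

End PG.

Section Generation.
Variables (gT : finGroupType) (O : operad gT).

Definition gamma_generated_from_below n (f : O n) : Prop :=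
  exists (m : nat) (s : O m) (k : 'I_m -> nat) (h : forall j, O (k j)),
    [/\ m < n, forall j, k j < n & Tagged O f = Tagged O (op_comp s h)].

Definition generated_from_below n (f' : O n) : Prop :=
  exists (f : O n) (s : 'S_n),
    gamma_generated_from_below f /\ f' = sact f s.

Local Open Scope classical_set_scope.

Record suboperad (N : forall n, set (O n)) : Prop := Suboperad {
  suboperad_gact : forall n a (x : O n), N n x -> N n (gact a x);
  suboperad_sact : forall n (x : O n) s, N n x -> N n (sact x s);
  suboperad_one : N 1 (op_one O);
  suboperad_comp : forall n (k : 'I_n -> nat) (x : O n) (y : forall j, O (k j)),
    N n x -> (forall j, N (k j) (y j)) -> N _ (op_comp x y)
}.

Definition generated_suboperad (S : forall n, set (O n)) (n : nat) : set (O n) :=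
  [set x | forall N : (forall n, set (O n)),
     suboperad N -> (forall i, S i `<=` N i) -> N n x].

Lemma generated_suboperadP (S : forall n, set (O n)) :
  [/\ suboperad (@generated_suboperad S),
      forall i, S i `<=` @generated_suboperad S i
    & forall N, suboperad N -> (forall i, S i `<=` N i) ->
        forall n, @generated_suboperad S n `<=` N n].
Proof.
split=> [|i x Sx N _ SN|N subN SN n x]; [|exact: SN|exact].
split=> [n a x Gx|n x s Gx||n k x y Gx Gy] N subN SN.
- by apply: (suboperad_gact subN); apply: Gx.
- by apply: (suboperad_sact subN); apply: Gx.
- exact: (suboperad_one subN).
- by apply: (suboperad_comp subN); [apply: Gx | move=> j; apply: Gy].
Qed.

Definition finitely_generated : Prop :=
  exists S : forall n, set (O n),
    finite_set [set u : {n : nat & O n} | S (tag u) (tagged u)] /\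
    forall n, @generated_suboperad S n = setT.

End Generation.

(* Main.v *)
(* An element of P_G(m) is a family of linear orders on m points indexed by G.
   Say that it is decomposable at n if, for each set A of n points, some B in A
   with 1 < |B| < n is an interval of A for all of these orders at once.  For
   n > 1 such elements form a suboperad: the restriction to A of a composite
   either meets a block in at least two points but not in all of A, and then
   that block gives B, or it is a restriction of one of the inner elements (all
   of A in one block) or of the outer element (at most one point per block).
   This suboperad contains all elements of arity less than n, vacuously, hence
   all those generated from below in arity n and, for large n, any given finite
   set of generators.  It misses the element of arity n whose orders are the
   identity at 1 and a simple permutation elsewhere. *)

Require Import Defs.
From mathcomp Require Import classical_sets cardinality.
From mathcomp Require Import all_boot all_order all_fingroup.
From mathcomp Require Import zify.

Set Implicit Arguments.
Unset Strict Implicit.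
Unset Printing Implicit Defensive.

(** * Order of the points of a composite *)

Section BlockOrder.
Variables (n : nat) (k : 'I_n -> nat) (s : 'S_n) (t : forall j, 'S_(k j)).

Lemma block_comp_lt_diff p q : tagnat.sig1 p != tagnat.sig1 q ->
  (block_comp s t p < block_comp s t q) =
  (s (tagnat.sig1 p) < s (tagnat.sig1 q)).
Proof. by move=> ne_pq; rewrite block_comp_ltE block_val_ltE. Qed.

Lemma block_comp_lt_Rank j (i i' : 'I_(k j)) :
  (block_comp s t (tagnat.Rank j i) < block_comp s t (tagnat.Rank j i')) =
  (t j i < t j i').
Proof. by rewrite !block_comp_RankE ltn_add2r. Qed.

End BlockOrder.

(** * Decomposable elements form a suboperad *)

Section Decomposable.
Variable gT : finGroupType.

(* The positions B form an interval among the positions A in each of the linear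
   orders [x h]. *)
Definition common_interval m (x : PG gT m) (A B : {set 'I_m}) : Prop :=
  forall h b b' c, b \in B -> b' \in B -> c \in A :\: B ->
    (x h b < x h c) = (x h b' < x h c).

Definition decomposable_on m (x : PG gT m) (A : {set 'I_m}) : Prop :=
  exists B : {set 'I_m},
    [/\ B \subset A, 1 < #|B| < #|A| & common_interval x A B].

Definition decomposable_at n m (x : PG gT m) : Prop :=
  forall A : {set 'I_m}, #|A| = n -> decomposable_on x A.

Lemma decomposable_at_lt n m (x : PG gT m) : m < n -> decomposable_at n x.
Proof.
move=> lt_mn A cardA; have := max_card (mem A).
by rewrite cardA card_ord leqNgt lt_mn.
Qed.

Lemma decomposable_at_gact n m a (x : PG gT m) :
  decomposable_at n x -> decomposable_at n (Defs.gact a x).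
Proof.
move=> dx A /dx [B [sBA cardB ciB]]; exists B; split=> // h b b' c Bb Bb' Ac.
by rewrite !ffunE; apply: ciB.
Qed.

Lemma decomposable_at_sact n m (x : PG gT m) s :
  decomposable_at n x -> decomposable_at n (sact x s).
Proof.
move=> dx A cardA.
have [|B [sBA cardB ciB]] := dx (s @: A).
  by rewrite card_imset //; apply: perm_inj.
have defB : s @: (s @^-1: B) = B.
  apply/setP => c; rewrite -[c](permKV s) mem_imset; last exact: perm_inj.
  by rewrite inE.
exists (s @^-1: B); split.
- apply/subsetP => b; rewrite inE => /(subsetP sBA) /imsetP[a Aa].
  by move/perm_inj ->.
- by rewrite -(card_imset _ (@perm_inj _ s)) defB
    -(card_imset (mem A) (@perm_inj _ s)).
- move=> h b b' c; rewrite !inE => Bb Bb' /andP[nBc Ac].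
  rewrite !ffunE !symME; apply: ciB => //.
  by rewrite inE nBc imset_f.
Qed.

Lemma decomposable_at_comp n m (k : 'I_m -> nat) (x : PG gT m)
    (y : forall j, PG gT (k j)) :
  1 < n -> decomposable_at n x -> (forall j, decomposable_at n (y j)) ->
  decomposable_at n (op_comp x y).
Proof.
move=> n_gt1 dx dy A cardA.
pose Ab j := [set p in A | tagnat.sig1 p == j].
have sAbA j : Ab j \subset A by apply/subsetP => p; rewrite inE => /andP[].
have [/existsP[j Abj_gt1]|/existsPn Ab_le1] := boolP [exists j, 1 < #|Ab j|].
  have [lt_Abj|le_Abj] := ltnP #|Ab j| #|A|.
    (* The outer orders compare all points of block [j] alike with a point outside it. *)
    exists (Ab j); split; rewrite ?sAbA ?Abj_gt1 //.
    move=> h b b' c; rewrite !inE => /andP[_ /eqP bj] /andP[_ /eqP b'j].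
    case/andP => + Ac; rewrite Ac /= => ne_cj; rewrite !ffunE.
    by rewrite !block_comp_lt_diff ?bj ?b'j // eq_sym.
  (* All of [A] lies in block [j]: pull it back along [tagnat.Rank] and decompose it for [y j]. *)
  have AbE : Ab j = A by apply/eqP; rewrite eqEcard sAbA.
  have Rinj : injective (@tagnat.Rank _ k j).
    by move=> i i' /tagnat.rank_inj /eqP; rewrite eq_Tagged => /eqP.
  pose A' := @tagnat.Rank _ k j @^-1: A.
  have defA : A = @tagnat.Rank _ k j @: A'.
    apply/setP => p; apply/idP/imsetP => [Ap|[i + ->]]; last by rewrite inE.
    have : p \in Ab j by rewrite AbE.
    rewrite inE => /andP[_ /eqP pj]; subst j.
    by exists (tagnat.sig2 p); rewrite ?inE tagnat.sig2K.
  have [|B [sBA cardB ciB]] := dy j A'.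
    by rewrite -cardA defA card_imset.
  exists (@tagnat.Rank _ k j @: B); split.
  - by rewrite defA imsetS.
  - by rewrite defA !card_imset.
  move=> h _ _ c /imsetP[b Bb ->] /imsetP[b' Bb' ->].
  rewrite inE => /andP[nBc]; rewrite defA => /imsetP[i A'i eq_c].
  move: nBc; rewrite eq_c mem_imset // => nBi.
  by rewrite !ffunE !block_comp_lt_Rank; apply: ciB => //; rewrite inE nBi.
(* [A] meets each block at most once, so [tagnat.sig1] carries it, with its orders, to a set of
   points of [x]. *)
have sig1_inj : {in A &, injective (@tagnat.sig1 _ k)}.
  move=> p q Ap Aq eq_pq; apply/eqP; have := Ab_le1 (tagnat.sig1 q).
  apply: contraR => ne_pq; rewrite (cardD1 p) (cardD1 q) !inE Ap Aq eq_pq eqxx.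
  by rewrite eq_sym ne_pq.
have [|B [sBA cardB ciB]] := dx (@tagnat.sig1 _ k @: A).
  by rewrite card_in_imset.
pose B' := A :&: @tagnat.sig1 _ k @^-1: B.
have sB'A : B' \subset A by apply: subsetIl.
have defB : B = @tagnat.sig1 _ k @: B'.
  apply/setP => j; apply/idP/imsetP => [Bj|[p + ->]]; last first.
    by rewrite !inE => /andP[].
  have /imsetP[p Ap eq_j] := subsetP sBA j Bj.
  by exists p; rewrite // !inE Ap -eq_j.
exists B'; split=> //.
  move: cardB; rewrite defB !card_in_imset //.
  by move=> p q /(subsetP sB'A) Ap /(subsetP sB'A) Aq; apply: sig1_inj.
move=> h b b' c; rewrite !inE => /andP[Ab_ Bb] /andP[Ab' Bb'] /andP[+ Ac].
rewrite Ac /= => nBc.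
have neB j : j \in B -> j != tagnat.sig1 c by apply: contraTneq => ->.
rewrite !ffunE !block_comp_lt_diff ?neB //; apply: ciB => //.
by rewrite inE nBc imset_f.
Qed.

Lemma decomposable_at_suboperad n : 1 < n ->
  suboperad (O := PG gT) (@decomposable_at n).
Proof.
move=> n_gt1; split.
- by move=> m a x; apply: decomposable_at_gact.
- by move=> m x s; apply: decomposable_at_sact.
- exact: decomposable_at_lt.
- by move=> m k x y; apply: decomposable_at_comp.
Qed.

Lemma generated_from_below_decomposable n (f : PG gT n) :
  1 < n -> generated_from_below f -> decomposable_at n f.
Proof.
move=> n_gt1 [f0 [s [[m [x [k [y [lt_mn lt_kn eq_f]]]]] ->]]].
apply: decomposable_at_sact.
(* The arities in [eq_f] are only propositionally equal, so the goal is moved to the dependent pair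
   before rewriting. *)
suff: decomposable_at n (tagged (Tagged (PG gT) f0)) by [].
rewrite eq_f; apply: decomposable_at_comp => // [|j];
  exact: decomposable_at_lt.
Qed.

End Decomposable.

(** * A simple permutation *)

Section Oscillation.
Variable n : nat.
Hypothesis n_gt3 : 3 < n.

(* The increasing oscillation 1, 3, 0, 5, 2, 7, 4, ... closed up at the right
   end; it is a simple permutation for every n > 3. *)
Definition osc (i : nat) : nat :=
  if odd i then if i.+2 < n then i.+2 else if i.+1 < n then i.+1 else n.-2
  else if i == 0 then 1 else i.-2.

Lemma osc_lt (i : 'I_n) : osc i < n.
Proof. by rewrite /osc; have := ltn_ord i; do !case: ifP; lia. Qed.

Lemma osc_inj : injective (fun i => Ordinal (osc_lt i)).
Proof.
move=> i j [eq_ij]; apply/val_inj => /=; move: eq_ij (ltn_ord i) (ltn_ord j).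
by rewrite /osc; do !case: ifP; lia.
Qed.

Definition osc_perm : 'S_n := perm osc_inj.

(** Keeps a common interval with at least two points from ending at a position [b] before the last.
    The witness is [b.+1] for [b] odd and usually [b.+2] for [b] even. *)
Lemma osc_between_right b : 0 < b -> b.+1 < n ->
  exists2 c, b < c < n
    & minn (osc b.-1) (osc b) < osc c < maxn (osc b.-1) (osc b).
Proof.
case: b => // b _ b_ltn /=; rewrite /osc /=.
have [->|b_neq0] := eqVneq b 0.
  have [->|n_neq4] := eqVneq n 4; first by exists 3.
  by exists 4; rewrite /= ?ifT; lia.
have [b_odd|b_even] /= := boolP (odd b); last first.
  by exists b.+2; rewrite /= ?negbK ?(negbTE b_even) /=; do ?case: ifP; lia.
have [b_lt|b_ge] := ltnP b.+3 n.
  by exists b.+3; rewrite /= ?negbK ?b_odd /= ?ifT; lia.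
by exists b.+2; rewrite /= ?negbK ?b_odd /=; do ?case: ifP; lia.
Qed.

(** Mirror image: keeps such an interval from starting at a position [a > 0]. *)
Lemma osc_between_left a : 0 < a -> a.+1 < n ->
  exists2 c, c < a
    & minn (osc a) (osc a.+1) < osc c < maxn (osc a) (osc a.+1).
Proof.
case: a => // -[|[|[|a]]] _ a_ltn; rewrite /osc /=.
- by exists 0 => //=; do ?case: ifP; lia.
- by exists 0 => //=; do ?case: ifP; lia.
- by exists 1 => //=; do ?case: ifP; lia.
rewrite !negbK; have [a_odd|a_even] /= := boolP (odd a).
  by exists a.+2 => //; rewrite /= ?negbK ?a_odd; do ?case: ifP; lia.
by exists a.+1 => //; rewrite /= ?a_even; do ?case: ifP; lia.
Qed.

End Oscillation.

(** * An indecomposable element *)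

Section Indecomposable.
Variables (gT : finGroupType) (n : nat).
Hypotheses (ntG : 1 < #|gT|) (n_gt3 : 3 < n).

Definition osc_elt : PG gT n :=
  [ffun h => if h == 1%g then 1%g else osc_perm n_gt3].

(** The order at 1 makes [B] a run of consecutive positions; the oscillation then pushes both its
    ends to the extremes. *)
Lemma osc_elt_indecomposable : ~ decomposable_at n osc_elt.
Proof.
case/(_ [set: 'I_n]); first by rewrite cardsT card_ord.
move=> B [_ /andP[B_gt1 B_ltn] ciB].
have [g /eqP g_neq1] : exists g : gT, g <> 1%g.
  have /card_gt1P[x [y [_ _ ne_xy]]] := ntG.
  have [x1|/eqP] := eqVneq x 1%g; last by exists x.
  by exists y => y1; rewrite x1 y1 eqxx in ne_xy.
have ciB_osc b b' c : b \in B -> b' \in B -> c \notin B ->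
    (osc n b < osc n c) = (osc n b' < osc n c).
  move=> Bb Bb' nBc; have := ciB g b b' c Bb Bb'.
  by rewrite inE nBc inE !ffunE (negbTE g_neq1) !permE; apply.
have convB (b b' c : 'I_n) : b \in B -> b' \in B -> b < c < b' -> c \in B.
  move=> Bb Bb' /andP[lt_bc lt_cb']; apply: contraT => nBc.
  have := ciB 1%g b b' c Bb Bb'; rewrite inE nBc inE !ffunE eqxx !perm1.
  by rewrite lt_bc ltnNge (ltnW lt_cb') => /(_ isT).
have /card_gt1P[b1 [b2 [Bb1 Bb2 ne_b]]] := B_gt1.
pose a := [arg min_(i < b1 in B) val i].
pose z := [arg max_(i > b1 in B) val i].
have [Ba minB] : a \in B /\ forall i, i \in B -> a <= i.
  by rewrite /a; case: arg_minnP.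
have [Bz maxB] : z \in B /\ forall i, i \in B -> i <= z.
  by rewrite /z; case: arg_maxnP.
have lt_az : a < z.
  have := minB _ Bb1; have := minB _ Bb2; have := maxB _ Bb1.
  have := maxB _ Bb2; move: ne_b; rewrite -val_eqE /=; lia.
have separated (b b' c : 'I_n) : b \in B -> b' \in B -> c \notin B ->
    minn (osc n b) (osc n b') < osc n c < maxn (osc n b) (osc n b') -> False.
  by move=> Bb Bb' nBc; have := ciB_osc b b' c Bb Bb' nBc; lia.
(* Otherwise convexity puts [z.-1], which is at least [a], in [B], and a value to the right of [z]
   separates the two. *)
have z_last : z.+1 = n.
  have [lt_zn|] := ltnP z.+1 n; last by have := ltn_ord z; lia.
  have z_gt0 : 0 < z by apply: leq_ltn_trans lt_az.
  have [c /andP[lt_zc lt_cn] sep_c] := osc_between_right n_gt3 z_gt0 lt_zn.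
  have ltz1 : z.-1 < n by lia.
  case: (separated (Ordinal ltz1) z (Ordinal lt_cn)) => //.
    have [<-|ne_a] := eqVneq a (Ordinal ltz1); first by [].
    apply: convB Ba Bz _ => /=; move: ne_a; rewrite -val_eqE /=; lia.
  by apply: contraL lt_zc => /maxB; rewrite -leqNgt.
have a_first : a = 0 :> nat.
  have [//|a_gt0] := posnP a.
  have lt_an : a.+1 < n by lia.
  have [c lt_ca sep_c] := osc_between_left n_gt3 a_gt0 lt_an.
  have lt_cn : c < n by lia.
  case: (separated a (Ordinal lt_an) (Ordinal lt_cn)) => //.
    have [<-|ne_z] := eqVneq z (Ordinal lt_an); first by [].
    apply: convB Ba Bz _ => /=; move: ne_z; rewrite -val_eqE /=; lia.
  by apply: contraL lt_ca => /minB; rewrite -leqNgt.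
have BT : B = [set: 'I_n].
  apply/setP => i; rewrite inE.
  have [<-//|ne_a] := eqVneq a i; have [<-//|ne_z] := eqVneq z i.
  apply: convB Ba Bz _; move: ne_a ne_z (ltn_ord i); rewrite -!val_eqE /=; lia.
by rewrite BT ltnn in B_ltn.
Qed.

End Indecomposable.

(** * Arities of generators and the conclusion *)

Lemma finite_arity_bound (T : nat -> Type) (S : forall n, set (T n)) :
  finite_set [set u : {n : nat & T n} | S (tag u) (tagged u)]%classic ->
  exists N, forall n x, S n x -> n < N.
Proof.
move=> /(finite_image (@tag nat T)) /finite_seqP[s eq_s].
exists (\max_(i <- s) i).+1 => n x Snx; rewrite ltnS.
apply: leq_bigmax_seq => //.
have : [set` s]%classic n; last by [].
by rewrite -eq_s; exists (Tagged T x).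
Qed.

Theorem theorem2p13 (gT : finGroupType) (ntG : (1 < #|gT|)%N) :
  (forall n : nat, (3 < n)%N ->
     exists f : PG gT n, ~ generated_from_below f) /\
  ~ finitely_generated (PG gT).
Proof.
split=> [n n_gt3|[S [/finite_arity_bound[N ltN] genS]]].
  exists (osc_elt gT n_gt3).
  move/(generated_from_below_decomposable (ltn_trans (isT : 1 < 3) n_gt3)).
  exact: osc_elt_indecomposable.
(* Arity [N + 4] exceeds 3 and the arity of every generator, so the generators are vacuously
   decomposable there. *)
have n_gt3 : 3 < N + 4 by lia.
suff: decomposable_at (N + 4) (osc_elt gT n_gt3).
  exact: osc_elt_indecomposable.
have : generated_suboperad S (osc_elt gT n_gt3) by rewrite genS.
apply; first by apply: decomposable_at_suboperad; lia.
move=> i x /ltN lt_iN; apply: decomposable_at_lt; lia.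
Qed.
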